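(* Under the standing assumptions of the context, assume that $s^0_{\alpha,D}\in[0,1]$ for all $D\in\mathcal D_h$ and $\alpha=l,g$, and let $(p^n_{l,D},p^n_{g,D})_{D\in\mathcal D_h,\,1\le n\le N}$ be a solution of the combined scheme. Then the saturations satisfy $s^n_{\alpha,D}\in[0,1]$ for all $D\in\mathcal D_h$, all $n\in\{1,\dots,N\}$ and $\alpha=l,g$.
   Context: **Continuous data and standing assumptions.** $d\in\{2,3\}$, $\Omega\subset\mathbb R^d$ is a bounded polyhedral domain, $\partial\Omega=\Gamma_l\cup\Gamma_{imp}$ ($\Gamma_l$ of positive surface measure), $T>0$, $Q_T=(0,T)\times\Omega$. The index $\alpha\in\{l,g\}$ denotes the phase, and $s_l+s_g=1$. Gravity is neglected. The assumptions are: (A1) $\phi_0\le\phi(x)\le\phi_1$ for a.e. $x\in\Omega$, with constants $\phi_0,\phi_1>0$. (A2) $\Lambda=(\Lambda_{ij})$ is a symmetric matrix field, $\Lambda_{ij}\in L^\infty(\Omega)$, $|\Lambda_{ij}|\le C_\Lambda/d$ a.e., and $\langle\Lambda(x)\xi,\xi\rangle\ge c_\Lambda|\xi|^2$ for all $\xi\in\mathbb R^d$, with $C_\Lambda,c_\Lambda>0$. (A3) The mobilities $M_l,M_g$ belong to $C^0([0,1],\mathbb R^+)$, $M_\alpha(0)=0$, and $M(s_l):=M_l(s_l)+M_g(1-s_l)\ge m_0>0$ for all $s_l\in[0,1]$. (A4) $f_P,f_I\in L^2(Q_T)$, $f_P,f_I\ge0$ a.e.; $s^I_\alpha$ are given measurable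 functions with values in $[0,1]$. (A5) $\rho_\alpha\in C^1(\mathbb R)$ is increasing and $0<\rho_m\le\rho_\alpha\le\rho_M$. (A6) $p_c\in C^1([0,1];\mathbb R^+)$ is decreasing, $0<\underline{p_c}\le|p_c'|$, and $p_c(1)=0$. (A7) $\gamma(s_l):=-\frac{M_l(s_l)M_g(1-s_l)}{M(s_l)}p_c'(s_l)$ is in $C^1([0,1];\mathbb R^+)$, positive on $(0,1)$, zero at $0$ and $1$; with $\mathcal B(s_l)=\int_0^{s_l}\gamma(z)\,dz$, the inverse $\mathcal B^{-1}$ is Hölder continuous of order $\theta\in(0,1]$ on $[0,\mathcal B(1)]$. Initial data: $p^0_l,p^0_g\in L^2(\Omega)$, with $s^0_l$ given by $p_c(s^0_l)=p^0_g-p^0_l$, $s^0_g=1-s^0_l$. Extensions: $M_\alpha(s)=0$ for $s\le0$, $M_\alpha(s)=M_\alpha(1)$ for $s\ge1$; $p_c$ is extended to a decreasing $C^1$ bijection of $\mathbb R$ with $|p_c'|\ge\underline{p_c}$. **Discretization.** $\mathcal T_h$ is a conforming triangulation of $\overline\Omega$ into closed simplices (two distinct simplices meet in the empty set or a common face, edge or vertex), each boundary side lying in $\overline{\Gamma_l}$ or in $\overline{\Gamma_{imp}}$; $h=\max_K\mathrm{diam}(K)$. Shape regularity: $\min_{K\in\mathcal T_h}|K|/\mathrm{diam}(K)^d\ge\kappa_{\mathcal T}>0$ with $\kappa_{\mathcal T}$ independent of $h$. $\mathcal D_h$ is the dual mesh: to each side ($(d-1)$-face) $\sigma_D$ of $\mathcal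 T_h$ corresponds the dual volume $D$, the union over the simplices $K$ containing $\sigma_D$ of the convex hulls of $\sigma_D$ and the barycentre of $K$. $Q_D$ is the barycentre of $\sigma_D$. $\mathcal N(D)$ is the set of dual volumes $E\neq D$ sharing an interior dual side $\sigma_{D,E}=\partial D\cap\partial E$ with $D$. $X_h$ is the space of functions in $L^2(\Omega)$ that are linear on each $K$ and continuous at $Q_D$ for every interior side; $\varphi_D\in X_h$ is its basis with $\varphi_D(Q_E)=\delta_{DE}$. The transmissibilities are $\Lambda_{D,E}=-\sum_{K\in\mathcal T_h}\int_K\Lambda\nabla\varphi_E\cdot\nabla\varphi_D\,dx$; they are assumed non-negative: $\Lambda_{D,E}\ge0$ for all $D\in\mathcal D_h$, $E\in\mathcal N(D)$. Time steps: $t^n=n\,\delta t$, $\delta t=T/N$. **Combined scheme.** $\phi_D$ is the mean of $\phi$ on $D$; $f^n_{P,D},f^n_{I,D},(s^I_{\alpha,D})^n$ are the means of $f_P,f_I,s^I_\alpha$ over $(t^{n-1},t^n)\times D$; $p^0_{\alpha,D},s^0_{\alpha,D}$ are the means of $p^0_\alpha,s^0_\alpha$ on $D$. Find $(p^n_{l,D},p^n_{g,D})$, $D\in\mathcal D_h$, $1\le n\le N$, such that $p^n_{l,D}=p^n_{g,D}=0$ if $\sigma_D\subset\overline{\Gamma_l}$ and, for all other $D$ and $\alpha=l,g$, $$|D|\phi_D\frac{\rho_\alpha(p^n_{\alpha,D})s^n_{\alpha,D}-\rho_\alpha(p^{n-1}_{\alpha,D})s^{n-1}_{\alpha,D}}{\delta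 t}-\sum_{E\in\mathcal N(D)}\rho^n_{\alpha,D,E}M_\alpha(s^n_{\alpha,D,E})\Lambda_{D,E}(p^n_{\alpha,E}-p^n_{\alpha,D})+|D|\rho_\alpha(p^n_{\alpha,D})s^n_{\alpha,D}f^n_{P,D}=|D|\rho_\alpha(p^n_{\alpha,D})(s^I_{\alpha,D})^nf^n_{I,D},$$ where for all $D$ and $n\ge1$: $p_c(s^n_{l,D})=p^n_{g,D}-p^n_{l,D}$ and $s^n_{g,D}=1-s^n_{l,D}$. Here $\frac1{\rho^n_{\alpha,D,E}}=\frac1{p^n_{\alpha,E}-p^n_{\alpha,D}}\int_{p^n_{\alpha,D}}^{p^n_{\alpha,E}}\frac{d\zeta}{\rho_\alpha(\zeta)}$ if $p^n_{\alpha,D}\ne p^n_{\alpha,E}$, and $\rho^n_{\alpha,D,E}=\rho_\alpha(p^n_{\alpha,D})$ otherwise; $s^n_{\alpha,D,E}=s^n_{\alpha,D}$ if $\Lambda_{D,E}(p^n_{\alpha,E}-p^n_{\alpha,D})\le0$, and $s^n_{\alpha,D,E}=s^n_{\alpha,E}$ otherwise. *)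

(* Defs.v *)
From HB Require Import structures.
From mathcomp Require Import all_boot all_order all_algebra finmap.
From mathcomp Require Import all_classical all_reals all_analysis.

Set Implicit Arguments.
Unset Strict Implicit.
Unset Printing Implicit Defensive.

Import Order.TTheory GRing.Theory Num.Theory.
Import numFieldNormedType.Exports.

Local Open Scope classical_set_scope.
Local Open Scope ring_scope.

Fact row_display : measure_display.
Proof. exact: default_measure_display. Qed.

Section measurable_row.
Variables (R : realType) (n : nat).

Let coords : 'I_n -> 'rV[R]_n -> R := fun i x => x ord0 i.

Let row_set0 : g_sigma_preimage coords set0.
Proof. exact: sigma_algebra0. Qed.

Let row_setC A : g_sigma_preimage coords A -> g_sigma_preimage coords (~` A).
Proof. exact: sigma_algebraC. Qed.

Let row_bigcup (F : (set 'rV[R]_n)^nat) :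
  (forall i, g_sigma_preimage coords (F i)) ->
  g_sigma_preimage coords (\bigcup_i (F i)).
Proof. exact: sigma_algebra_bigcup. Qed.

(* R^n is 'rV[R]_n with the sigma-algebra generated by the coordinates, which is
   the Borel one. *)
HB.instance Definition _ := @isMeasurable.Build
  row_display 'rV[R]_n (g_sigma_preimage coords)
  row_set0 row_setC row_bigcup.

End measurable_row.

Section lebesgue_row.
Variable R : realType.

Lemma measurable_row_coord n (i : 'I_n) :
  measurable_fun [set: 'rV[R]_n] (fun x : 'rV[R]_n => x ord0 i).
Proof.
move=> _ Y mY; rewrite setTI; apply: sub_sigma_algebra => /=.
rewrite -bigcup_seq/=; exists i => /=; first by rewrite mem_index_enum.
by exists Y => //; rewrite setTI.
Qed.

Lemma measurable_fun_row d (T : measurableType d) n (f : T -> 'rV[R]_n) :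
  (forall i, measurable_fun [set: T] (fun x => f x ord0 i)) ->
  measurable_fun [set: T] f.
Proof.
move=> mf.
suff : @measurable _ 'rV[R]_n `<=` [set A | d.-measurable (f @^-1` A)].
  by move=> + _ A mA => /(_ A mA); rewrite setTI.
apply: smallest_sub; first split => //=.
- by rewrite preimage_set0.
- by move=> A mA; rewrite setTD preimage_setC; exact: measurableC.
- by move=> F mF; rewrite preimage_bigcup; exact: bigcupT_measurable.
move=> A; rewrite -bigcup_seq => -[i _ [B mB <-]] /=.
by rewrite setTI -comp_preimage -[X in measurable X]setTI; exact: mf.
Qed.

(* (t, x) |-> (t, x_0, ..., x_(n-1)) *)
Definition row_cons n (p : R * 'rV[R]_n) : 'rV[R]_n.+1 :=
  \row_j oapp (fun k => p.2 ord0 k) p.1 (unlift ord0 j).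

Lemma measurable_row_cons n : measurable_fun [set: R * 'rV[R]_n] (@row_cons n).
Proof.
apply: measurable_fun_row => j.
under eq_fun do rewrite mxE.
case: (unlift ord0 j) => [k|] /=; last exact: measurable_fst.
exact: (measurableT_comp (measurable_row_coord k)).
Qed.

Definition row_uncons n (x : 'rV[R]_n.+1) : R * 'rV[R]_n :=
  (x ord0 ord0, \row_k x ord0 (lift ord0 k)).

Lemma row_consK n : cancel (@row_cons n) (@row_uncons n).
Proof.
move=> [t x]; rewrite /row_uncons mxE unlift_none /=; congr pair.
by apply/rowP => k; rewrite !mxE liftK.
Qed.

Lemma measurable_row_uncons n : measurable_fun [set: 'rV[R]_n.+1] (@row_uncons n).
Proof.
apply: measurable_fun_pair; first exact: measurable_row_coord.
apply: measurable_fun_row => k.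
under eq_fun do rewrite mxE.
exact: measurable_row_coord.
Qed.

Section step.
Variables (n : nat) (mu : {sigma_finite_measure set 'rV[R]_n -> \bar R}).

Definition lebesgue_step : set 'rV[R]_n.+1 -> \bar R :=
  pushforward (@lebesgue_measure R \x mu)%E (@row_cons n).

Let mcons A : measurable A -> measurable (@row_cons n @^-1` A).
Proof. by move=> mA; rewrite -[X in measurable X]setTI; exact: measurable_row_cons. Qed.

Let lebesgue_step0 : lebesgue_step set0 = 0%E.
Proof. by rewrite /lebesgue_step /pushforward preimage_set0 measure0. Qed.

Let lebesgue_step_ge0 A : (0 <= lebesgue_step A)%E.
Proof. by rewrite /lebesgue_step /pushforward measure_ge0. Qed.

Let lebesgue_step_sigma_additive : semi_sigma_additive lebesgue_step.
Proof.
move=> F mF tF mUF; rewrite /lebesgue_step /pushforward preimage_bigcup.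
apply: measure_semi_sigma_additive.
- by move=> k; exact: mcons.
- apply/trivIsetP => /= i j _ _ ij; rewrite -preimage_setI.
  by move/trivIsetP : tF => /(_ _ _ _ _ ij) ->//; rewrite preimage_set0.
- by rewrite -preimage_bigcup; exact: mcons.
Qed.

HB.instance Definition _ := isMeasure.Build _ _ _ lebesgue_step
  lebesgue_step0 lebesgue_step_ge0 lebesgue_step_sigma_additive.

Let lebesgue_step_sigma_finite : sigma_finite setT lebesgue_step.
Proof.
have /sigma_finiteP[F [FT ndF Foo]] := sigma_finiteT (@lebesgue_measure R).
have /sigma_finiteP[G [GT ndG Goo]] := sigma_finiteT mu.
exists (fun k => @row_uncons n @^-1` (F k `*` G k)) => [|k].
  rewrite -preimage_bigcup (_ : \bigcup_k _ = setT) ?preimage_setT//.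
  rewrite -setXTT FT GT predeqE => -[x y]; split.
    by move=> [k _ [Fx Gy]]; split; exists k.
  move=> [/= [k _ Fkx] [l _ Gly]]; exists (maxn k l) => //; split.
  - by move: x Fkx; exact/subsetPset/ndF/leq_maxl.
  - by move: y Gly; exact/subsetPset/ndG/leq_maxr.
have [[mF Flt] [mG Glt]] := (Foo k, Goo k); split.
  rewrite -[X in measurable X]setTI; apply: measurable_row_uncons => //.
  exact: measurableX.
rewrite /lebesgue_step /pushforward -comp_preimage.
rewrite (_ : _ \o _ = id); last by apply/funext => p /=; exact: row_consK.
by rewrite preimage_id product_measure1E// lte_mul_pinfty// ge0_fin_numE.
Qed.

HB.instance Definition _ := Measure_isSigmaFinite.Build _ _ _ lebesgue_step
  lebesgue_step_sigma_finite.

End step.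

Fixpoint lebesgue_row n : {sigma_finite_measure set 'rV[R]_n -> \bar R} :=
  match n with
  | 0%N => [the {sigma_finite_measure set 'rV[R]_0 -> \bar R} of
              \d_(0 : 'rV[R]_0)]
  | m.+1 => [the {sigma_finite_measure set 'rV[R]_m.+1 -> \bar R} of
              lebesgue_step (lebesgue_row m)]
  end.

Lemma lebesgue_rowS n (A : set R) (B : set 'rV[R]_n) :
  measurable A -> measurable B ->
  lebesgue_row n.+1 (@row_uncons n @^-1` (A `*` B)) =
  (@lebesgue_measure R A * lebesgue_row n B)%E.
Proof.
move=> mA mB; rewrite /= /lebesgue_step /pushforward -comp_preimage.
rewrite (_ : _ \o _ = id); last by apply/funext => p /=; exact: row_consK.
by rewrite preimage_id product_measure1E.
Qed.

End lebesgue_row.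

Section geometry.
Variables (R : realType) (d : nat).
Local Notation V := 'rV[R]_d.
Implicit Types (A B : set V) (F G : {fset V}).

Definition dot (u v : V) : R := (u *m v^T) ord0 ord0.

Definition enorm (u : V) : R := Num.sqrt (dot u u).

Definition bdry A : set V := closure A `\` interior A.

Definition ediam A : \bar R :=
  ereal_sup ([set 0%E] `|` [set (enorm (p.1 - p.2))%:E | p in A `*` A]).

(* s-dimensional Hausdorff measure up to its normalising constant, which is
   irrelevant here: it is only used to say that a surface measure is positive *)
Definition hausdorff (s : nat) A : \bar R :=
  ereal_sup [set ereal_inf [set (\sum_(0 <= k <oo) ediam (U k) ^+ s)%E |
      U in [set U : nat -> set V |
             A `<=` \bigcup_k U k /\ forall k, (ediam (U k) <= e%:E)%E]]
    | e in [set e : R | 0 < e]].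

(* Convex hull of a finite set; simplices and their faces are represented by
   their finite sets of vertices. *)
Definition hull F : set V :=
  [set x | exists w : V -> R, [/\ forall v, v \in F -> 0 <= w v,
     \sum_(v <- F) w v = 1 & x = \sum_(v <- F) w v *: v]].

Definition affinely_independent F : Prop :=
  forall w : V -> R, \sum_(v <- F) w v = 0 -> \sum_(v <- F) w v *: v = 0 ->
  forall v, v \in F -> w v = 0.

Definition is_simplex F : Prop := #|` F| = d.+1 /\ affinely_independent F.

Definition barycentre F : V := (#|` F|%:R)^-1 *: \sum_(v <- F) v.

Definition vol A : R := fine (lebesgue_row R d A).

Definition diam F : R := fine (ediam (hull F)).

Definition polyhedral_domain (Omega : set V) : Prop :=
  [/\ open Omega, connected Omega, Omega !=set0, bounded_set Omega &
      exists P : {fset {fset V}}, (forall F, F \in P -> #|` F| = d) /\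
        bdry Omega = \bigcup_(F in [set` P]) hull F].

Section mesh.
Variables (Omega Gl Gimp : set V) (Th : {fset {fset V}}).

Definition sides : {fset {fset V}} :=
  (\bigcup_(K <- Th) [fset F in fpowerset K | #|` F| == d])%fset.

Definition boundary_side F : Prop := hull F `<=` bdry Omega.

Record triangulation : Prop := {
  mesh_simplex : forall K, K \in Th -> is_simplex K ;
  mesh_cover : \bigcup_(K in [set` Th]) hull K = closure Omega ;
  mesh_conforming : forall K L, K \in Th -> L \in Th -> K != L ->
    exists F, [/\ (F `<=` K)%fset, (F `<=` L)%fset & hull K `&` hull L = hull F] ;
  mesh_boundary : forall F, F \in sides -> boundary_side F ->
    hull F `<=` closure Gl \/ hull F `<=` closure Gimp ;
  mesh_shape_regular : exists kappa : R, 0 < kappa /\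
    forall K, K \in Th -> kappa <= vol (hull K) / diam K ^+ d }.

Definition dual_volume F : set V :=
  \bigcup_(K in [set K | K \in Th /\ (F `<=` K)%fset])
    hull (barycentre K |` F)%fset.

(* the interior sides of the dual mesh *)
Definition interior_dual_side A : Prop := exists K F,
  [/\ K \in Th, (F `<=` K)%fset, #|` F| = d.-1 &
      A = hull (barycentre K |` F)%fset].

Definition neighbour F G : Prop :=
  F != G /\ interior_dual_side (bdry (dual_volume F) `&` bdry (dual_volume G)).

(* limit of u at x along the interiors of the simplices: elements of X_h are
   only defined almost everywhere and are in general discontinuous across the
   sides away from their barycentres *)
Definition node_value (u : V -> R) (x : V) (a : R) : Prop :=
  u y @[y --> within (\bigcup_(K in [set` Th]) interior (hull K)) (nbhs x)] --> a.

Definition Xh (u : V -> R) : Prop :=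
  [/\ (u \_ Omega : V -> R) \in Lfun (lebesgue_row R d) 2%:E,
      forall K, K \in Th -> exists (g : V) (c : R),
        forall x, interior (hull K) x -> u x = dot g x + c &
      forall F, F \in sides -> ~ boundary_side F ->
        exists a, node_value u (barycentre F) a].

Definition nodal_basis (psi : sides -> V -> R) : Prop :=
  forall D, Xh (psi D) /\
    forall E : sides, node_value (psi D) (barycentre (val E)) (D == E)%:R.

Definition grad (u : V -> R) (x : V) : V := \row_i 'D_(delta_mx ord0 i) u x.

(* Integral over A of a function that is only meaningful on Omega; for A
   contained in the closure of Omega the part left out lies in the boundary of
   Omega, which is negligible. *)
Definition int_on (A : set V) (f : V -> R) : R :=
  \int[lebesgue_row R d]_(x in A `&` Omega) f x.

Definition transmissibility (Lambda : V -> 'M[R]_d) (psi : sides -> V -> R)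
    (D E : sides) : R :=
  - \sum_(K <- Th) int_on (hull K) (fun x =>
      dot (grad (psi E) x *m (Lambda x)^T) (grad (psi D) x)).

Definition mean (f : V -> R) (D : sides) : R :=
  int_on (dual_volume (val D)) f / vol (dual_volume (val D)).

Definition time_mean (dt : R) (n : nat) (f : R * V -> R) (D : sides) : R :=
  (\int[(@lebesgue_measure R \x lebesgue_row R d)%E]_(q in
      `]n.-1%:R * dt, n%:R * dt[ `*` (dual_volume (val D) `&` Omega)) f q)
  / (dt * vol (dual_volume (val D))).

End mesh.
End geometry.

Section functions_of_one_variable.
Variable R : realType.
Implicit Types (f : R -> R) (a b : R).

Definition C1 f : Prop := (forall x, derivable f x 1) /\ continuous f^`()%classic.

Definition C1_itv a b f : Prop :=
  [/\ {within `[a, b], continuous f}, {in `]a, b[, forall x, derivable f x 1} &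
      exists g : R -> R, {within `[a, b], continuous g} /\
        {in `]a, b[, f^`()%classic =1 g}].

Definition oriented_int f a b : R :=
  if a <= b then \int[lebesgue_measure]_(x in `[a, b]) f x
  else - \int[lebesgue_measure]_(x in `[b, a]) f x.

End functions_of_one_variable.

Variant phase := liquid | gas.

Record two_phase_data (R : realType) (d : nat) := TwoPhaseData {
  Omega : set 'rV[R]_d ;
  Gl : set 'rV[R]_d ;
  Gimp : set 'rV[R]_d ;
  final_time : R ;
  porosity : 'rV[R]_d -> R ;
  Lambda : 'rV[R]_d -> 'M[R]_d ;
  mob : phase -> R -> R ;
  fP : R * 'rV[R]_d -> R ;
  fI : R * 'rV[R]_d -> R ;
  sI : phase -> R * 'rV[R]_d -> R ;
  rho : phase -> R -> R ;
  pc : R -> R ;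
  p0 : phase -> 'rV[R]_d -> R ;
  s0 : phase -> 'rV[R]_d -> R }.

Section assumptions.
Variables (R : realType) (d : nat) (Q : two_phase_data R d).
Local Notation V := 'rV[R]_d.
Local Notation mu := (lebesgue_row R d).
Local Notation tmu := (@lebesgue_measure R \x lebesgue_row R d)%E.

Definition QT : set (R * V) := `]0, final_time Q[ `*` Omega Q.

Definition total_mobility (s : R) : R := mob Q liquid s + mob Q gas (1 - s).

Definition gamma (s : R) : R :=
  - (mob Q liquid s * mob Q gas (1 - s) / total_mobility s) * (pc Q)^`()%classic s.

Definition capB (s : R) : R := \int[lebesgue_measure]_(z in `[0, s]) gamma z.

(* The mobilities and the capillary pressure are the extended ones. *)
Record standing_assumptions : Prop := {
  dimension_range : d = 2 \/ d = 3 ;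
  domain_polyhedral : polyhedral_domain (Omega Q) ;
  domain_boundary : bdry (Omega Q) = Gl Q `|` Gimp Q ;
  Gl_positive : (0 < hausdorff d.-1 (Gl Q))%E ;
  final_time_gt0 : 0 < final_time Q ;
  porosity_measurable : measurable_fun (Omega Q) (porosity Q) ;
  porosity_bounds : exists phi0 phi1 : R, [/\ 0 < phi0, 0 < phi1 &
    {ae mu, forall x, Omega Q x -> phi0 <= porosity Q x <= phi1}] ;
  Lambda_measurable : forall i j,
    measurable_fun (Omega Q) (fun x => Lambda Q x i j) ;
  Lambda_symmetric : {ae mu, forall x, Omega Q x -> (Lambda Q x)^T = Lambda Q x} ;
  Lambda_bounded : exists C : R, 0 < C /\ forall i j,
    {ae mu, forall x, Omega Q x -> `|Lambda Q x i j| <= C / d%:R} ;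
  Lambda_elliptic : exists c : R, 0 < c /\
    {ae mu, forall x, Omega Q x -> forall xi : V,
       c * enorm xi ^+ 2 <= dot (xi *m (Lambda Q x)^T) xi} ;
  mob_continuous : forall al, {within `[0, 1], continuous (mob Q al)} ;
  mob_ge0 : forall al, {in `[0, 1], forall s, 0 <= mob Q al s} ;
  mob0 : forall al, mob Q al 0 = 0 ;
  total_mobility_gt0 : exists m0 : R, 0 < m0 /\
    {in `[0, 1], forall s, m0 <= total_mobility s} ;
  mob_le0 : forall al s, s <= 0 -> mob Q al s = 0 ;
  mob_ge1 : forall al s, 1 <= s -> mob Q al s = mob Q al 1 ;
  fP_L2 : (fP Q \_ QT : R * V -> R) \in Lfun tmu 2%:E ;
  fI_L2 : (fI Q \_ QT : R * V -> R) \in Lfun tmu 2%:E ;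
  fP_ge0 : {ae tmu, forall q, QT q -> 0 <= fP Q q} ;
  fI_ge0 : {ae tmu, forall q, QT q -> 0 <= fI Q q} ;
  sI_measurable : forall al, measurable_fun QT (sI Q al) ;
  sI_range : forall al q, QT q -> 0 <= sI Q al q <= 1 ;
  rho_C1 : forall al, C1 (rho Q al) ;
  rho_increasing : forall al, {homo rho Q al : x y / x <= y} ;
  rho_bounds : exists rm rM : R, 0 < rm /\
    forall al x, rm <= rho Q al x <= rM ;
  pc_C1 : C1 (pc Q) ;
  pc_decreasing : {homo pc Q : x y /~ x < y} ;
  pc_bijective : bijective (pc Q) ;
  pc_ge0 : {in `[0, 1], forall s, 0 <= pc Q s} ;
  pc_slope : exists c : R, 0 < c /\ forall s, c <= `|(pc Q)^`()%classic s| ;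
  pc1 : pc Q 1 = 0 ;
  gamma_C1 : C1_itv 0 1 gamma ;
  gamma_gt0 : {in `]0, 1[, forall s, 0 < gamma s} ;
  gamma0 : gamma 0 = 0 ;
  gamma1 : gamma 1 = 0 ;
  capB_inv_hoelder : exists (Binv : R -> R) (theta C : R),
    [/\ 0 < theta <= 1, {in `[0, 1], cancel capB Binv} &
        {in `[0, capB 1] &, forall x y,
           `|Binv x - Binv y| <= C * `|x - y| `^ theta}] ;
  p0_L2 : forall al, (p0 Q al \_ (Omega Q) : V -> R) \in Lfun mu 2%:E ;
  s0_liquid : forall x, Omega Q x ->
    pc Q (s0 Q liquid x) = p0 Q gas x - p0 Q liquid x ;
  s0_gas : forall x, Omega Q x -> s0 Q gas x = 1 - s0 Q liquid x }.

End assumptions.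

Section scheme.
Variables (R : realType) (d : nat) (Q : two_phase_data R d).
Variable Th : {fset {fset 'rV[R]_d}}.
Variable psi : sides Th -> 'rV[R]_d -> R.
Variable N : nat.
Variables p s : nat -> phase -> sides Th -> R.
Implicit Types (n : nat) (al : phase) (D E : sides Th).

Definition dt : R := final_time Q / N%:R.

Definition vol_dual D : R := vol (dual_volume Th (val D)).

Definition trans D E : R := transmissibility (Omega Q) (Lambda Q) psi D E.

Definition rho_mean n al D E : R :=
  if p n al D == p n al E then rho Q al (p n al D)
  else ((p n al E - p n al D)^-1 *
        oriented_int (fun z => (rho Q al z)^-1) (p n al D) (p n al E))^-1.

Definition upwind n al D E : R :=
  if trans D E * (p n al E - p n al D) <= 0 then s n al D else s n al E.

Definition dirichlet_side D : Prop := hull (val D) `<=` closure (Gl Q).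

Definition balance n al D : Prop :=
  vol_dual D * mean (Omega Q) (porosity Q) D *
    ((rho Q al (p n al D) * s n al D
      - rho Q al (p n.-1 al D) * s n.-1 al D) / dt)
  - \sum_(E | `[< neighbour Th (val D) (val E) >])
      rho_mean n al D E * mob Q al (upwind n al D E) * trans D E *
      (p n al E - p n al D)
  + vol_dual D * rho Q al (p n al D) * s n al D *
      time_mean (Omega Q) dt n (fP Q) D
  = vol_dual D * rho Q al (p n al D) * time_mean (Omega Q) dt n (sI Q al) D *
      time_mean (Omega Q) dt n (fI Q) D.

Record combined_scheme_solution : Prop := {
  init_pressure : forall al D, p 0 al D = mean (Omega Q) (p0 Q al) D ;
  init_saturation : forall al D, s 0 al D = mean (Omega Q) (s0 Q al) D ;
  dirichlet_pressure : forall n al D, (0 < n <= N)%N -> dirichlet_side D ->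
    p n al D = 0 ;
  scheme_balance : forall n al D, (0 < n <= N)%N -> ~ dirichlet_side D ->
    balance n al D ;
  capillary_law : forall n D, (0 < n <= N)%N ->
    pc Q (s n liquid D) = p n gas D - p n liquid D ;
  saturation_sum : forall n D, (0 < n <= N)%N ->
    s n gas D = 1 - s n liquid D }.

End scheme.

(* Main.v *)
(* Suppose s < 0 at a dual volume D. Then D is not a Dirichlet side, where
   p_c(s_l) = 0 = p_c(1) forces s_l = 1. In the balance over D every upwind flux
   into D is nonnegative, since M_alpha(s) = 0, and the sources have the sign
   opposite to the accumulation term; that term would have to be nonnegative,
   whereas by induction on the time level it is negative. No minimising D is
   needed. The strict sign rests on |D| phi_D > 0: the hull of the barycentre of
   K and a side of K is again a nondegenerate simplex, so D has interior points,
   and since D lies in the closure of Omega it meets Omega in a set of positive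
   measure. *)

Require Import Defs.
From mathcomp Require Import all_boot all_order all_algebra finmap.
From mathcomp Require Import all_classical all_reals all_analysis.
From mathcomp Require Import measurable_realfun.

Set Implicit Arguments.
Unset Strict Implicit.
Unset Printing Implicit Defensive.

Import Order.TTheory GRing.Theory Num.Theory.
Import numFieldNormedType.Exports.

Local Open Scope classical_set_scope.
Local Open Scope ring_scope.

(** * Lebesgue measure of cubes, open sets and bounded sets in ['rV[R]_n] *)

Section row_measure.
Variables (R : realType) (n : nat).
Implicit Types (A : set 'rV[R]_n) (c : 'rV[R]_n) (r : R).

(** The [ball] of row vectors carries the condition [0 < r] itself, which matters for [n = 0], where
    there is no coordinate to constrain. *)
Lemma row_ballE c r : 0 < r ->
  ball c r = [set x : 'rV[R]_n | forall i, `|c ord0 i - x ord0 i| < r].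
Proof.
move=> r0; apply/seteqP; split => [x [_ /= h] i|x /= h]; first exact: h.
by split => // i j; rewrite ord1; exact: h.
Qed.

Lemma measurable_row_ball c r : measurable (ball c r : set 'rV[R]_n).
Proof.
have [r0|r0] := ltP 0 r; last first.
  rewrite (_ : ball c r = set0) //; apply/seteqP; split => // x [].
  by rewrite ltNge r0.
rewrite row_ballE // (_ : [set _ | _] =
  ~` \bigcup_(i in [set: 'I_n]) ((fun x : 'rV[R]_n => x ord0 i) @^-1` ~` ball (c ord0 i) r)).
  apply: measurableC; apply: countable_bigcupT_measurable => // i.
  rewrite -[X in measurable X]setTI.
  apply: measurable_row_coord => //.
  by apply: measurableC; apply: open_measurable; exact: ball_open.
apply/seteqP; split => x /=.
  by move=> h [i _ /=]; apply; exact: h.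
by move=> h i; apply: contrapT => hi; apply: h; exists i.
Qed.

(** The sigma-algebra is generated by coordinates, not by open sets; second countability bridges the
    two, an open set being a countable union of balls with rational centre and radius. *)
Lemma measurable_row_open A : open A -> measurable A.
Proof.
move=> oA.
pose B (q : 'rV[rat]_n * rat) := ball (map_mx (@ratr R) q.1) (ratr q.2 : R).
rewrite (_ : A = \bigcup_(q in [set q | B q `<=` A]) B q).
  rewrite bigcup_mkcond; apply: countable_bigcupT_measurable => // q.
  by case: ifP => // _; exact: measurable_row_ball.
apply/seteqP; split => [x Ax|x [q /= qA]]; last exact: qA.
have /nbhs_ballP[e /= e0 eA] : nbhs x A by exact: open_nbhs_nbhs.
(* With radius [q < e / 2] and a centre within [q] of [x], the ball contains [x] and, by the
   triangle inequality, stays in [ball x e]. *)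
have [q /itvP qe] : exists q : rat, ratr q \in `]0, (e / 2)[ by apply: rat_in_itvoo; rewrite divr_gt0.
have q0 : 0 < ratr q :> R by rewrite qe.
have /choice [c hc] : forall i, exists t : rat, ball (ratr t : R) (ratr q) (x ord0 i).
  move=> i; have [t /itvP ht] := @rat_in_itvoo R (x ord0 i) (x ord0 i + ratr q) ltac:(by rewrite ltrDl).
  by exists t; rewrite /ball /= ger0_norm ?subr_ge0 ?ht // ltrBlDl ht.
exists (\row_i c i, q) => [y|]; last first.
  by split => // i j; rewrite ord1 !mxE; exact: hc.
move=> [_ hy]; apply: eA; split => // i j; rewrite ord1.
have := hy ord0 j; rewrite !mxE /= => hyj.
have := ball_triangle (ball_sym (hc j)) hyj.
by apply: le_ball; rewrite [leRHS]splitr lerD // ltW // qe.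
Qed.

End row_measure.

(** Balls of the sup norm are cubes of side [2r], so peeling off one coordinate writes them as
    products; in dimension 0 the Dirac mass gives 1. *)
Lemma lebesgue_row_ball (R : realType) n (c : 'rV[R]_n) (r : R) : 0 < r ->
  lebesgue_row R n (ball c r) = ((r *+ 2) ^+ n)%:E.
Proof.
move=> r0; elim: n c => [|n IH] c.
  rewrite (_ : ball c r = setT) /=; last first.
    by apply/seteqP; split => // x _; split => // i [].
  by rewrite diracT expr0.
rewrite (_ : ball c r = @row_uncons R n @^-1`
    (ball (c ord0 ord0) r `*` ball (row_uncons c).2 r)).
  rewrite lebesgue_rowS; [|by apply: open_measurable; exact: ball_open|exact: measurable_row_ball].
  by rewrite IH lebesgue_measure_ball ?ltW // -EFinM -exprS.
apply/seteqP; split => x.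
  move=> [_ h]; split; first exact: h.
  by split => // i j; rewrite !mxE; exact: h.
move=> [h0 [_ h]]; split => // i j; rewrite ord1.
have [k ->|->] := unliftP ord0 j; last exact: h0.
by have := h ord0 k; rewrite !mxE.
Qed.

Lemma lebesgue_row_bounded (R : realType) n (A : set 'rV[R]_n) :
  bounded_set A -> measurable A -> (lebesgue_row R n A < +oo)%E.
Proof.
move=> [M [_ hM]] mA.
(* One unit gets strictly above [M], as [bounded_set] demands; the other gives the strict inequality
   of an open ball. *)
pose r : R := `|M| + 2; have r0 : 0 < r by rewrite ltr_wpDl.
apply: (@le_lt_trans _ _ (lebesgue_row R n (ball (0 : 'rV[R]_n) r))); last first.
  by rewrite lebesgue_row_ball // ltry.
apply: le_measure; rewrite ?inE //; first exact: measurable_row_ball.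
move=> x Ax; rewrite -ball_normE /ball_ /= sub0r normrN.
have := hM (`|M| + 1); rewrite (le_lt_trans (ler_norm M)) ?ltrDl // => /(_ isT x Ax) /=.
by move=> /le_lt_trans; apply; rewrite ltrD2l ltr1n.
Qed.

Lemma lebesgue_row_open_gt0 (R : realType) n (A : set 'rV[R]_n) :
  open A -> A !=set0 -> (0 < lebesgue_row R n A)%E.
Proof.
move=> oA [x Ax].
have /nbhs_ballP[e /= e0 eA] : nbhs x A by exact: open_nbhs_nbhs.
apply: (@lt_le_trans _ _ (lebesgue_row R n (ball x e))).
  by rewrite lebesgue_row_ball // lte_fin exprn_gt0 // mulrn_wgt0.
apply: le_measure; rewrite ?inE //; first exact: measurable_row_ball.
exact: measurable_row_open.
Qed.

(** * Simplices, barycentric coordinates and convex hulls *)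

Section simplex.
Variables (R : realType) (d : nat).
Implicit Types (F K : {fset 'rV[R]_d}).

(* The rows (g_i, 1) of a simplex form an invertible matrix, whose inverse gives
   the barycentric coordinates. *)
Lemma simplex_hull_halfspaces F : is_simplex F ->
  exists (M : 'M[R]_(d, d + 1)) (r : 'rV[R]_(d + 1)),
    hull F = [set x | forall i, 0 <= (x *m M + r) ord0 i] /\
    exists x, forall i, 0 < (x *m M + r) ord0 i.
Proof.
move=> [cF aF].
have sF : size F = (d + 1)%N by rewrite addn1.
pose g (i : 'I_(d + 1)) := nth 0 F i.
have gF i : g i \in F by rewrite mem_nth // sF.
have gI : injective g.
  move=> i j /eqP; rewrite nth_uniq ?sF ?fset_uniq // => /eqP; exact: val_inj.
have gS (U : lmodType R) (f : 'rV[R]_d -> U) : \sum_(v <- F) f v = \sum_i f (g i).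
  by rewrite (big_nth 0) sF big_mkord.
have gP v : v \in F -> exists i, v = g i.
  move=> vF; have hi : (index v F < d + 1)%N by rewrite -sF index_mem.
  by exists (Ordinal hi); rewrite /g /= nth_index.
(* [W c] turns weights indexed by vertex number into a function on vectors, the form used by [hull]
   and [affinely_independent]. *)
pose W (c : 'rV[R]_(d + 1)) v := \sum_i (v == g i)%:R * c ord0 i.
have Wg c i : W c (g i) = c ord0 i.
  rewrite /W (bigD1 i) //= eqxx mul1r big1 ?addr0 // => j ji.
  by rewrite (inj_eq gI) eq_sym (negbTE ji) mul0r.
pose B : 'M[R]_(d + 1) := \matrix_i row_mx (g i) 1.
have cB c : c *m B = row_mx (\sum_i c ord0 i *: g i) (\sum_i c ord0 i)%:M.
  apply/rowP => j; rewrite mxE; case: (split_ordP j) => k ->.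
    rewrite row_mxEl summxE; apply: eq_bigr => i _.
    by rewrite mxE row_mxEl mxE.
  rewrite row_mxEr ord1 mxE eqxx mulr1n; apply: eq_bigr => i _.
  by rewrite mxE row_mxEr mxE eqxx mulr1.
(* By [cB], the left kernel of [B] consists of the affine relations between the vertices. *)
have uB : B \in unitmx.
  rewrite -row_free_unit -kermx_eq0; apply/rowV0P => c /sub_kermxP.
  rewrite cB -[0 in RHS]row_mx0 => /eq_row_mx[c1 c2].
  apply/rowP => i; rewrite mxE -Wg; apply: aF => //.
    rewrite (gS R^o); under eq_bigr do rewrite Wg.
    by have := congr1 (fun M : 'M[R]_1 => M ord0 ord0) c2; rewrite !mxE eqxx mulr1n.
  by rewrite gS; under eq_bigr do rewrite Wg.
pose M := usubmx (invmx B); pose r := dsubmx (invmx B).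
have MrE x : x *m M + r = row_mx x 1 *m invmx B.
  by rewrite -[invmx B]vsubmxK mul_row_col mul1mx.
have coordP x c : c = x *m M + r <->
    x = \sum_i c ord0 i *: g i /\ \sum_i c ord0 i = 1.
  rewrite MrE; split => [cE|[-> c1]].
    have : c *m B = row_mx x 1 by rewrite cE mulmxKV.
    rewrite cB => /eq_row_mx[<- /(congr1 (fun M : 'M[R]_1 => M ord0 ord0))].
    by rewrite !mxE eqxx mulr1n.
  have -> : row_mx (\sum_i c ord0 i *: g i) 1 = c *m B by rewrite cB c1.
  by rewrite mulmxK.
exists M, r; split.
  apply/seteqP; split => [x [w [w0 w1 xE]] i|x /= x0].
    rewrite -(proj2 (coordP x (\row_i w (g i)))) ?mxE ?w0 //.
    rewrite xE gS -w1 (gS R^o).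
    by split; apply: eq_bigr => j _; rewrite mxE.
  have [xE x1] := proj1 (coordP x _) erefl.
  exists (W (x *m M + r)); split.
  - by move=> v /gP[i ->]; rewrite Wg.
  - by rewrite (gS R^o); under eq_bigr do rewrite Wg.
  - by rewrite gS; under eq_bigr do rewrite Wg.
(* The strictly positive point is the barycentre, with equal coordinates. *)
pose c : 'rV[R]_(d + 1) := const_mx (d + 1)%:R^-1.
have d1 : (0 : R) < (d + 1)%:R by rewrite ltr0n addn1.
exists (\sum_i c ord0 i *: g i) => i.
rewrite -(proj2 (coordP _ c)) ?mxE ?invr_gt0 //; split => //.
under eq_bigr do rewrite mxE.
by rewrite sumr_const card_ord -[LHS]mulr_natl divff // gt_eqF.
Qed.

Let continuous_coord m (M : 'M[R]_(d, m)) (r : 'rV[R]_m) i :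
  continuous (fun x : 'rV[R]_d => (x *m M + r) ord0 i).
Proof.
rewrite (_ : (fun _ => _) =
    (fun x : 'rV[R]_d => \sum_(j < d) x ord0 j * M j i) \+ cst (r ord0 i));
  last by apply/funext => x; rewrite !mxE.
move=> x; apply: continuousD; last exact: cst_continuous.
move: x; apply: continuous_big => [|j _ x]; first exact: add_continuous.
by apply: continuousM; [exact: coord_continuous|exact: cst_continuous].
Qed.

Lemma simplex_hull_closed F : is_simplex F -> closed (hull F).
Proof.
move=> /simplex_hull_halfspaces[M [r [-> _]]].
rewrite (_ : [set _ | _] = \bigcap_(i in [set: 'I_(d + 1)])
    (fun x : 'rV[R]_d => (x *m M + r) ord0 i) @^-1` [set y | 0 <= y]).
  apply: closed_bigI => i _; apply: closed_comp; last exact: closed_ge.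
  by move=> x _; exact: continuous_coord.
by apply/seteqP; split => x /= h i; [move=> _|]; exact: h.
Qed.

(** At the barycentre finitely many continuous functions are positive, hence all remain nonnegative
    nearby. *)
Lemma simplex_hull_interior F : is_simplex F -> (hull F)° !=set0.
Proof.
move=> /simplex_hull_halfspaces[M [r [-> [x x0]]]]; exists x.
apply: (@filter_forall _ _ _ (nbhs x)) => i.
exact: (cvgr_ge _ (@continuous_coord _ M r i x)).
Qed.

Lemma simplex_split K F : is_simplex K -> (F `<=` K)%fset -> #|` F| = d ->
  exists2 v, v \notin F & K = (v |` F)%fset.
Proof.
move=> [cK _] FK cF.
have /cardfs1P[v KF] : #|` K `\` F|%fset == 1%N.
  by rewrite cardfsDS // cK cF subSnn.
exists v; first by have := fset11 v; rewrite -KF in_fsetD => /andP[].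
apply/fsetP => x; have /fsetP/(_ x) := KF; rewrite !inE => <-.
by case: (boolP (x \in F)) => [/(fsubsetP FK)->|_]; rewrite ?orbT ?orbF.
Qed.

(* Rewriting the barycentre turns an affine relation on b |` F into one on K
   whose weight at the vertex opposite to F is w b / #|K|. *)
Lemma is_simplex_barycentre K F :
  is_simplex K -> (F `<=` K)%fset -> #|` F| = d ->
  is_simplex (barycentre K |` F)%fset.
Proof.
move=> sK FK cF; have [v vF KE] := simplex_split sK FK cF.
have [cK aK] := sK; set b := barycentre K.
have d1 : (d.+1%:R : R) != 0 by rewrite pnatr_eq0.
have bE : b = d.+1%:R^-1 *: (v + \sum_(x <- F) x).
  by rewrite /b /barycentre cK KE big_fsetU1.
have key c (w : 'rV[R]_d -> R) : c + \sum_(x <- F) w x = 0 ->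
    c *: b + \sum_(x <- F) w x *: x = 0 ->
    c = 0 /\ forall x, x \in F -> w x = 0.
  move=> s0 c0.
  (* Every vertex of [K] receives an equal share of the weight [c] of [b]; the test discards the
     arbitrary value of [w] at [v], outside [F]. *)
  pose w' x := (if x == v then 0 else w x) + c / d.+1%:R.
  have wF x : x \in F -> w' x = w x + c / d.+1%:R.
    by rewrite /w'; case: eqP => // ->; rewrite (negbTE vF).
  have wv : w' v = c / d.+1%:R by rewrite /w' eqxx add0r.
  have h : forall x, x \in K -> w' x = 0.
    apply: aK; rewrite KE big_fsetU1 //= wv big_seq.
      under eq_bigr => x xF do rewrite wF //.
      rewrite -big_seq big_split /= big_const_seq count_predT.
      rewrite iter_addr_0.
      rewrite cF addrCA -[RHS]s0 [RHS]addrC; congr (_ + _).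
      by rewrite -mulrS -[LHS]mulr_natr divfK.
    under eq_bigr => x xF do rewrite wF // scalerDl.
    rewrite -big_seq big_split /= addrCA -scaler_sumr -scalerDr -scalerA.
    by rewrite -bE addrC.
  have c00 : c = 0.
    have := h v; rewrite KE fset1U1 wv => /(_ isT) /eqP.
    by rewrite mulf_eq0 invr_eq0 (negbTE d1) orbF => /eqP.
  split=> // x xF; have := h x; rewrite KE fset1Ur // wF // c00 mul0r addr0.
  exact.
(* Otherwise weight 1 on [b] and weight -1 on its copy in [F] would contradict [key]. *)
have bF : b \notin F.
  apply/negP => bF.
  have [] := key 1 (fun x => - (x == b)%:R); last by move/eqP; rewrite oner_eq0.
    rewrite (big_fsetD1 b) //= eqxx big_seq big1 ?addr0 ?subrr // => x.
    by rewrite !inE => /andP[/negbTE-> _]; rewrite oppr0.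
  rewrite (big_fsetD1 b) //= eqxx big_seq big1 ?addr0 ?scaleN1r ?scale1r ?subrr // => x.
  by rewrite !inE => /andP[/negbTE-> _]; rewrite oppr0 scale0r.
split; first by rewrite cardfsU1 bF cF.
move=> w; rewrite !big_fsetU1 //= => s0 c0.
have [wb wF] := key _ _ s0 c0.
by move=> x; rewrite !inE => /orP[/eqP->|/wF].
Qed.

(** Convex combinations compose: weights [W v] expressing each [v] through [G] are averaged with the
    weights [w v]. *)
Lemma hull_min (F G : {fset 'rV[R]_d}) :
  (forall v, v \in F -> hull G v) -> hull F `<=` hull G.
Proof.
move=> FG x [w [w0 w1 ->]].
have /choice[W hW] : forall v, exists W : 'rV[R]_d -> R, v \in F ->
    [/\ forall u, u \in G -> 0 <= W u, \sum_(u <- G) W u = 1 &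
        v = \sum_(u <- G) W u *: u].
  move=> v; case: (boolP (v \in F)) => [/FG[W hW]|_]; first by exists W.
  by exists (fun=> 0).
exists (fun u => \sum_(v <- F) w v * W v u); split.
- move=> u uG; rewrite big_seq sumr_ge0 // => v vF.
  by rewrite mulr_ge0 ?w0 //; have [->] := hW v vF.
- rewrite exchange_big -w1 big_seq [RHS]big_seq; apply: eq_bigr => v vF.
  by rewrite -mulr_sumr; have [_ -> _] := hW v vF; rewrite mulr1.
- under [RHS]eq_bigr do rewrite scaler_suml.
  rewrite exchange_big big_seq [RHS]big_seq; apply: eq_bigr => v vF.
  have [_ _ vE] := hW v vF.
  by rewrite [X in _ *: X = _]vE scaler_sumr; apply: eq_bigr => u _; rewrite scalerA.
Qed.

Lemma hull_vertex F v : v \in F -> hull F v.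
Proof.
move=> vF; exists (fun u => (u == v)%:R); split => //.
- rewrite (big_fsetD1 v) //= eqxx big_seq big1 ?addr0 // => u.
  by rewrite !inE => /andP[/negbTE->].
- rewrite (big_fsetD1 v) //= eqxx big_seq big1 ?addr0 ?scale1r // => u.
  by rewrite !inE => /andP[/negbTE-> _]; rewrite scale0r.
Qed.

Lemma hull_barycentre F : F != fset0 -> hull F (barycentre F).
Proof.
rewrite -cardfs_eq0 => cF; exists (fun=> (#|` F|%:R)^-1); split => [v _||].
- by rewrite invr_ge0.
- rewrite big_const_seq count_predT iter_addr_0 -[LHS]mulr_natr mulVf //.
  by rewrite pnatr_eq0.
- by rewrite -scaler_sumr.
Qed.

Lemma hull_barycentre_sub K F : K != fset0 -> (F `<=` K)%fset ->
  hull (barycentre K |` F)%fset `<=` hull K.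
Proof.
move=> K0 FK; apply: hull_min => v; rewrite !inE => /orP[/eqP->|vF].
  exact: hull_barycentre.
by apply: hull_vertex; exact: (fsubsetP FK).
Qed.

End simplex.

(** * Signs of integrals under almost-everywhere bounds *)

Section integral_sign.
Context {disp : measure_display} {T : measurableType disp} {R : realType}.
Variable mu : {measure set T -> \bar R}.
Implicit Types (A : set T) (f : T -> R).

(** Almost everywhere on [A], [f] equals its positive part, whose integral is nonnegative; [fine]
    preserves this even at infinity. *)
Lemma Rintegral_ae_ge0 A B f : measurable A -> A `<=` B -> measurable_fun A f ->
  {ae mu, forall x, B x -> 0 <= f x} -> 0 <= \int[mu]_(x in A) f x.
Proof.
move=> mA AB mf f0; rewrite /Rintegral (@ae_eq_integral _ _ _ _ _ (EFin \o (f \max cst 0))) //.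
- by apply: Rintegral_ge0 => x _; rewrite le_max lexx orbT.
- exact/measurable_EFinP.
- by apply/measurable_EFinP; apply: measurable_maxr => //; exact: measurable_cst.
- by apply: filterS f0 => x h /AB/h fx /=; rewrite max_l.
Qed.

Lemma Rintegral_ae_gt0 A f (a b : R) : measurable A -> measurable_fun A f ->
  (0 < mu A < +oo)%E -> 0 < a -> {ae mu, forall x, A x -> a <= f x <= b} ->
  0 < \int[mu]_(x in A) f x.
Proof.
move=> mA mf /andP[A0 Aoo] a0 fab; rewrite /Rintegral.
(* Clamping makes the bounds hold everywhere. The upper one is essential to positivity, since [fine]
   sends an infinite integral to 0. *)
pose g x := Num.max a (Num.min (f x) b).
have mg : measurable_fun A (EFin \o g).
  apply/measurable_EFinP; apply: measurable_maxr; first exact: measurable_cst.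
  by apply: measurable_minr => //; exact: measurable_cst.
have ag x : a <= g x by rewrite le_max lexx.
rewrite (@ae_eq_integral _ _ _ _ _ (EFin \o g)) //; last 2 first.
- exact/measurable_EFinP.
- apply: filterS fab => x h Ax /=; have /andP[af fb] := h Ax.
  by rewrite /g min_l // max_r.
apply: fine_gt0; apply/andP; split.
  apply: (@lt_le_trans _ _ (\int[mu]_(x in A) cst a%:E x)%E).
    by rewrite integral_cst // mule_gt0.
  apply: ge0_le_integral => //; first by move=> x _; rewrite lee_fin ltW.
  by move=> x _; rewrite lee_fin.
apply: (@le_lt_trans _ _ (\int[mu]_(x in A) cst (Num.max a b)%:E x)%E).
  apply: ge0_le_integral => //; first by move=> x _; rewrite lee_fin (le_trans (ltW a0)).
  by move=> x _; rewrite lee_fin /g ge_max !le_max lexx /= !ge_min lexx !orbT.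
by rewrite integral_cst // lte_mul_pinfty // lee_fin le_max ltW.
Qed.

End integral_sign.

(** * Measurability, boundedness and positive volume of dual volumes *)

Section dual_mesh.
Variables (R : realType) (d : nat) (Omega Gl Gimp : set 'rV[R]_d).
Variable Th : {fset {fset 'rV[R]_d}}.
Hypotheses (HO : polyhedral_domain Omega) (HTh : triangulation Omega Gl Gimp Th).
Local Notation mu := (lebesgue_row R d).

Lemma sideP (D : sides Th) : #|` val D| = d /\
  exists2 K, K \in Th & (val D `<=` K)%fset.
Proof.
have /bigfcupP[K /andP[KTh _]] := valP D.
by rewrite !inE /= fpowersetE => /andP[DK /eqP]; split=> //; exists K.
Qed.

Lemma simplex_in_domain K : K \in Th -> hull K `<=` closure Omega.
Proof. by move=> KTh x Kx; rewrite -(mesh_cover HTh); exists K. Qed.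

Lemma simplex_neq0 K : K \in Th -> K != fset0.
Proof. by move=> KTh; rewrite -cardfs_eq0 (proj1 (mesh_simplex HTh KTh)). Qed.

(** A dual volume is a finite union of closed simplices. *)
Lemma measurable_dual_volume (D : sides Th) : measurable (dual_volume Th (val D)).
Proof.
apply: fin_bigcup_measurable.
  by apply: (sub_finite_set _ (finite_fset Th)) => K [].
move=> K [KTh DK]; rewrite -[X in measurable X]setCK; apply: measurableC.
apply: measurable_row_open; apply: closed_openC; apply: simplex_hull_closed.
by apply: is_simplex_barycentre => //; [exact: mesh_simplex HTh _ KTh|exact: (sideP D).1].
Qed.

Lemma dual_volume_sub (D : sides Th) : dual_volume Th (val D) `<=` closure Omega.
Proof.
move=> x [K [KTh DK] Kx]; apply: (simplex_in_domain KTh).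
exact: hull_barycentre_sub (simplex_neq0 KTh) DK _ Kx.
Qed.

Lemma measurable_domain : measurable Omega.
Proof. by case: HO => oO _ _ _ _; exact: measurable_row_open. Qed.

Lemma bounded_dual_volume (D : sides Th) : bounded_set (dual_volume Th (val D)).
Proof.
case: HO => _ _ _ [M [Mr hM]] _; exists M; split => // r /hM hr y /dual_volume_sub.
(* Closed norm balls transfer the bound from [Omega] to its closure. *)
have cr : closed ((Num.norm : 'rV[R]_d -> R) @^-1` [set t | t <= r]).
  by apply: closed_comp; [move=> z _; exact: norm_continuous|exact: closed_le].
by move=> /(closure_subset hr); rewrite -(proj1 (closure_id _) cr).
Qed.

(* Dual volumes lie in the closure of Omega only, but their interior must meet
   Omega in a nonempty open set; no estimate on the boundary is needed. *)
Lemma lebesgue_dual_volume_gt0 (D : sides Th) :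
  (0 < mu (dual_volume Th (val D) `&` Omega))%E.
Proof.
have oO : open Omega by case: HO.
have [cD [K KTh DK]] := sideP D.
have sb := is_simplex_barycentre (mesh_simplex HTh KTh) DK cD.
have [x xb] := simplex_hull_interior sb.
pose U := (hull (barycentre K |` val D)%fset)° `&` Omega.
have UD : U `<=` dual_volume Th (val D) `&` Omega.
  by move=> y [/interior_subset yb yO]; split => //; exists K.
have oU : open U by apply: openI => //; exact: open_interior.
apply: (@lt_le_trans _ _ (mu U)).
  apply: lebesgue_row_open_gt0 => //.
  (* A point of the closure has points of [Omega] in each neighbourhood, in particular in the
     interior of the small simplex. *)
  have /(_ _ (open_nbhs_nbhs (conj (open_interior _) xb))) : closure Omega x.
    apply: (@dual_volume_sub D); exists K => //; exact: interior_subset xb.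
  by move=> [y [yO yb]]; exists y.
apply: le_measure; rewrite ?inE //; first exact: measurable_row_open.
by apply: measurableI; [exact: measurable_dual_volume|exact: measurable_domain].
Qed.

Lemma lebesgue_dual_volume_lty (D : sides Th) :
  (mu (dual_volume Th (val D)) < +oo)%E.
Proof. exact: lebesgue_row_bounded (@bounded_dual_volume D) (measurable_dual_volume D). Qed.

Lemma vol_dual_volume_gt0 (D : sides Th) : 0 < vol (dual_volume Th (val D)).
Proof.
apply: fine_gt0; rewrite lebesgue_dual_volume_lty andbT.
apply: lt_le_trans (lebesgue_dual_volume_gt0 D) _.
apply: le_measure; rewrite ?inE //; last exact: measurable_dual_volume.
by apply: measurableI; [exact: measurable_dual_volume|exact: measurable_domain].
Qed.

Lemma mean_gt0 (f : 'rV[R]_d -> R) (a b : R) (D : sides Th) :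
  measurable_fun Omega f -> 0 < a ->
  {ae mu, forall x, Omega x -> a <= f x <= b} -> 0 < mean Omega f D.
Proof.
move=> mf a0 fab; rewrite /mean divr_gt0 ?vol_dual_volume_gt0 //.
have mD := measurable_dual_volume D; have mO := measurable_domain.
apply: (@Rintegral_ae_gt0 _ _ _ _ _ _ a b) => //.
- exact: measurableI.
- by apply: measurable_funS mf.
- rewrite lebesgue_dual_volume_gt0 (le_lt_trans _ (lebesgue_dual_volume_lty D)) //.
  by apply: le_measure; rewrite ?inE //; exact: measurableI.
- by apply: filterS fab => x h [_ /h].
Qed.

End dual_mesh.

(** * Signs of the averaged source terms *)

Section source_terms.
Variables (R : realType) (d : nat) (Q : two_phase_data R d).
Variable Th : {fset {fset 'rV[R]_d}}.
Hypotheses (HQ : standing_assumptions Q).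
Hypothesis HTh : triangulation (Omega Q) (Gl Q) (Gimp Q) Th.
Variables (N n : nat).
Hypothesis nN : (0 < n <= N)%N.
Implicit Types D : sides Th.

Let N0 : (0 : R) < N%:R.
Proof. by rewrite ltr0n; case/andP: nN => n0 /(leq_trans n0). Qed.

Lemma dt_gt0 : 0 < dt Q N.
Proof. by rewrite divr_gt0 ?final_time_gt0. Qed.

(** For levels between 1 and [N] the time slab lies in [QT], the only place where the source data
    are controlled. *)
Let slab_sub D : `]n.-1%:R * dt Q N, n%:R * dt Q N[ `*`
  (dual_volume Th (val D) `&` Omega Q) `<=` QT Q.
Proof.
move=> [t x] /= [tn [_ xO]]; split => //=; move: tn; rewrite !in_itv /= => /andP[t0 tn].
apply/andP; split.
  by apply: le_lt_trans t0; rewrite mulr_ge0 ?ler0n // ltW ?dt_gt0.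
apply: (lt_le_trans tn); rewrite /dt mulrCA ger_pMr ?final_time_gt0 //.
by rewrite ler_pdivrMr // mul1r ler_nat; case/andP: nN.
Qed.

Let time_vol_ge0 D : 0 <= dt Q N * vol (dual_volume Th (val D)).
Proof. by rewrite mulr_ge0 ?ltW ?dt_gt0 // (vol_dual_volume_gt0 (domain_polyhedral HQ) HTh). Qed.

Lemma time_mean_ge0 (f : R * 'rV[R]_d -> R) D :
  (forall q, QT Q q -> 0 <= f q) -> 0 <= time_mean (Omega Q) (dt Q N) n f D.
Proof.
by move=> f0; rewrite divr_ge0 // Rintegral_ge0 // => q /slab_sub /f0.
Qed.

(** This version serves [fP] and [fI], whose sign is known almost everywhere; the pointwise one
    above serves [sI]. *)
Lemma time_mean_Lfun_ge0 (f : R * 'rV[R]_d -> R) D :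
  (f \_ (QT Q) : R * 'rV[R]_d -> R) \in
    Lfun (@lebesgue_measure R \x lebesgue_row R d)%E 2%:E ->
  {ae (@lebesgue_measure R \x lebesgue_row R d)%E, forall q, QT Q q -> 0 <= f q} ->
  0 <= time_mean (Omega Q) (dt Q N) n f D.
Proof.
rewrite inE /= => /andP[/set_mem mf _] f0; rewrite divr_ge0 //.
apply: Rintegral_ae_ge0; [| exact: (@slab_sub D) | | exact: f0].
- apply: measurableX => //; apply: measurableI.
    exact: measurable_dual_volume HTh D.
  exact: measurable_domain (domain_polyhedral HQ).
(* Membership in [Lfun] gives measurability of the extension by zero, which coincides with [f] on
   the slab. *)
- apply: (eq_measurable_fun (f \_ (QT Q))); last exact: measurable_funTS.
  by move=> q; rewrite inE => /slab_sub qQ; rewrite patchT // inE.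
Qed.

End source_terms.

(** * Signs of mobilities, mean densities and upwind fluxes *)

Section fluxes.
Variables (R : realType) (d : nat) (Q : two_phase_data R d).
Variable Th : {fset {fset 'rV[R]_d}}.
Variable psi : sides Th -> 'rV[R]_d -> R.
Variables p s : nat -> phase -> sides Th -> R.
Hypotheses (HQ : standing_assumptions Q).

(** The constant extensions outside the unit interval matter: upwind saturations are not yet known
    to lie in it. *)
Lemma mobility_ge0 al x : 0 <= mob Q al x.
Proof.
have [x0|x0] := leP x 0; first by rewrite mob_le0.
have [x1|x1] := leP 1 x; first by rewrite (mob_ge1 HQ) // (mob_ge0 HQ) // in_itv /= ler01 lexx.
by rewrite (mob_ge0 HQ) // in_itv /= !ltW.
Qed.

Lemma density_gt0 al x : 0 < rho Q al x.
Proof.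
by have [rm [rM [rm0 /(_ al x)/andP[h _]]]] := rho_bounds HQ; exact: lt_le_trans h.
Qed.

(** The pressure difference and the oriented integral change sign together. *)
Lemma rho_mean_ge0 n al (D E : sides Th) : 0 <= rho_mean Q p n al D E.
Proof.
rewrite /rho_mean; case: eqP => [_|_]; first exact/ltW/density_gt0.
have inv_ge0 x : 0 <= (rho Q al x)^-1 by rewrite invr_ge0 ltW ?density_gt0.
rewrite invr_ge0 /oriented_int; case: (leP (p n al D) (p n al E)) => h.
  by rewrite mulr_ge0 ?invr_ge0 ?subr_ge0 // Rintegral_ge0.
by rewrite mulr_le0 ?invr_le0 ?subr_le0 ?oppr_le0 ?Rintegral_ge0 // ltW.
Qed.

(* Upwinding: an outgoing flux carries the mobility of D, which vanishes for a
   nonpositive saturation. *)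
Lemma upwind_flux_ge0 n al (D E : sides Th) : s n al D <= 0 ->
  0 <= rho_mean Q p n al D E * mob Q al (upwind Q psi p s n al D E) *
       trans Q psi D E * (p n al E - p n al D).
Proof.
move=> sD; rewrite -mulrA /upwind; case: (leP (_ * _) 0) => h.
  by rewrite (mob_le0 HQ) // mulr0 mul0r.
by rewrite mulr_ge0 ?(ltW h) // mulr_ge0 ?rho_mean_ge0 ?mobility_ge0.
Qed.

End fluxes.

(** * The maximum principle for the saturations *)

Theorem lemma5p1 (R : realType) (d : nat) (Q : two_phase_data R d)
    (Th : {fset {fset 'rV[R]_d}}) (psi : sides Th -> 'rV[R]_d -> R)
    (N : nat) (p s : nat -> phase -> sides Th -> R)
    (HQ : standing_assumptions Q)
    (HTh : triangulation (Omega Q) (Gl Q) (Gimp Q) Th)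
    (Hpsi : nodal_basis (Omega Q) psi)
    (Htrans : forall D E : sides Th, neighbour Th (val D) (val E) ->
       0 <= trans Q psi D E)
    (HN : (0 < N)%N)
    (Hs0 : forall (al : phase) (D : sides Th),
       0 <= mean (Omega Q) (s0 Q al) D <= 1)
    (Hsol : combined_scheme_solution Q psi N p s) :
  forall (n : nat) (al : phase) (D : sides Th), (0 < n <= N)%N ->
    0 <= s n al D <= 1.
Proof.
have HO := domain_polyhedral HQ.
(* Nonnegativity of both phases suffices, as they sum to 1. Level 0 is included to start the
   induction. *)
have s_ge0 n : (n <= N)%N -> forall al D, 0 <= s n al D.
  elim: n => [_ al D|n IH nN al D].
    by rewrite (init_saturation Hsol); case/andP: (Hs0 al D).
  have n1N : (0 < n.+1 <= N)%N by [].
  have [dD|dD] := pselect (dirichlet_side Q D).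
    have sl : s n.+1 liquid D = 1.
      apply: (bij_inj (pc_bijective HQ)).
      by rewrite (capillary_law Hsol) // !(dirichlet_pressure Hsol) // subrr (pc1 HQ).
    by case: al; rewrite ?(saturation_sum Hsol) // sl ?subrr.
  rewrite leNgt; apply/negP => sneg.
  have [phi0 [phi1 [phi0_gt0 _ phi_ae]]] := porosity_bounds HQ.
  have phiD := mean_gt0 HO HTh D (porosity_measurable HQ) phi0_gt0 phi_ae.
  have volD : 0 < vol_dual D := vol_dual_volume_gt0 HO HTh D.
  have rhoD m : 0 < rho Q al (p m al D) := density_gt0 HQ al _.
  have fPD := time_mean_Lfun_ge0 HQ HTh n1N D (fP_L2 HQ) (fP_ge0 HQ).
  have fID := time_mean_Lfun_ge0 HQ HTh n1N D (fI_L2 HQ) (fI_ge0 HQ).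
  have sID : 0 <= time_mean (Omega Q) (dt Q N) n.+1 (sI Q al) D.
    by apply: (time_mean_ge0 HQ HTh n1N) => q /(sI_range HQ al)/andP[].
  have := scheme_balance Hsol al n1N dD; rewrite /balance /=.
  set rhs := (X in _ = X); set flux := (\sum_(_ | _) _).
  have rhs_ge0 : 0 <= rhs by do !apply: mulr_ge0 => //; exact: ltW.
  have flux_ge0 : 0 <= flux by apply: sumr_ge0 => E _; apply: upwind_flux_ge0 => //; exact: ltW.
  move=> bal; move: rhs_ge0; rewrite -bal leNgt => /negP; apply.
  (* Accumulation minus flux will be strictly negative; the production term, with the sign of the
     saturation, is nonpositive. *)
  rewrite -[ltRHS]addr0 ltr_leD //; last first.
    by rewrite mulr_le0_ge0 // pmulr_rle0 ?mulr_gt0 // ltW.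
  rewrite subr_lt0 (lt_le_trans _ flux_ge0) // (pmulr_rlt0 _ (mulr_gt0 volD phiD)).
  rewrite pmulr_llt0 ?invr_gt0 ?(dt_gt0 HQ n1N) // subr_lt0.
  (* Zero separates the new phase mass from the old one, which is nonnegative by induction. *)
  rewrite (@lt_le_trans _ _ 0) ?pmulr_rlt0 //.
  by apply: mulr_ge0; [exact: ltW|apply: IH; exact: ltnW].
move=> n al D nN; have /andP[_ nN'] := nN; rewrite s_ge0 //=.
case: al; last by rewrite (saturation_sum Hsol) // gerBl s_ge0.
by rewrite -subr_ge0 -(saturation_sum Hsol) // s_ge0.
Qed.
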